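(* Let $\varphi\in L^1(\mathbb{R})$ have non-compact support and satisfy $\int_{-\infty}^{\infty}e^{|t|s}|\varphi(t)|\,dt<\infty$ for all $s>0$. Define $$p(s)=-\log\int_{|t|\ge s}|\varphi(t)|\,dt,\qquad p^*(s)=\sup_{t\ge0}[st-p(t)],\qquad p^{**}(t)=\sup_{s\ge0}[st-p^*(s)],\qquad G(s)=\int_0^\infty e^{ts-p(t)}\,dt$$ for $s,t\ge0$. Then $$\liminf_{s\to\infty}\frac{\log G(s)}{p^*(s)}\ge1,$$ and for any $\kappa>0$ $$\limsup_{s\to\infty}\frac{\log G(s)}{p^*(s+\kappa)}\le1.$$ If additionally at least one of the following two conditions holds: (a) the function $t\mapsto\exp\{-p(t)+\frac1\gamma p(\gamma t)\}$ belongs to $L^1(0,\infty)$ for all $0<\gamma<1$ close enough to $1$; (b) the function $t\mapsto\exp\{-p^{**}(t)+\frac1\gamma p^{**}(\gamma t)\}$ belongs to $L^1(0,\infty)$ for all $0<\gamma<1$ close enough to $1$; then $$\lim_{s\to\infty}\frac{\log G(s)}{p^*(s)}=1.$$ *)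

(* Defs.v *)
(* MathComp-Analysis; complex numbers R[i] from mathcomp-real-closed. *)
From HB Require Import structures.
From mathcomp Require Import all_boot all_order all_algebra.
From mathcomp Require Import complex.
From mathcomp Require Import all_classical all_reals all_analysis.

Set Implicit Arguments.
Unset Strict Implicit.
Unset Printing Implicit Defensive.

Import Order.TTheory GRing.Theory Num.Theory.
Import numFieldNormedType.Exports.

Local Open Scope classical_set_scope.
Local Open Scope ring_scope.
Local Open Scope ereal_scope.

(* Real-valued modulus: the ring-scope norm of R[i] takes its values in R[i]. *)
Definition cmod (R : realType) (z : R[i]) : R := Normc.normc z.

(* L^1(R) for complex-valued functions; the real case is Im \o phi = 0. *)
Definition complex_L1 (R : realType) (phi : R -> R[i]) : Prop :=
  (@lebesgue_measure R).-integrable setT (fun t => (complex.Re (phi t))%:E) /\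
  (@lebesgue_measure R).-integrable setT (fun t => (complex.Im (phi t))%:E).

(* Support of an a.e.-class of functions: the complement of the largest open
   set on which phi vanishes almost everywhere (not the closure of
   [set t | phi t != 0], which depends on the representative). *)
Definition ess_support (R : realType) (phi : R -> R[i]) : set R :=
  ~` \bigcup_(U in [set U : set R | open U /\
        {ae @lebesgue_measure R, forall t, U t -> phi t = 0%R}]) U.

(* All quantities below are extended reals, so that logarithms, suprema and
   integrals are junk-free even before their finiteness is known. *)

Definition tail_exponent (R : realType) (phi : R -> R[i]) (s : R) : \bar R :=
  - lne (\int[@lebesgue_measure R]_(t in [set t : R | (s <= `|t|)%R])
           (cmod (phi t))%:E).

Definition legendre (R : realType) (f : R -> \bar R) (s : R) : \bar R :=
  ereal_sup [set (s * t)%:E - f t | t in `[0%R, +oo[].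

Definition laplace_growth (R : realType) (p : R -> \bar R) (s : R) : \bar R :=
  \int[@lebesgue_measure R]_(t in `[0%R, +oo[) expeR ((t * s)%:E - p t).

(* "For all 0 < gamma < 1 close enough to 1" is the left filter at 1. *)
Definition dilation_integrable (R : realType) (f : R -> \bar R) : Prop :=
  \forall gamma \near (1%R : R)^'-,
    (@lebesgue_measure R).-integrable `]0%R, +oo[
      (fun t => expeR (- f t + (gamma^-1)%:E * f (gamma * t)%R)).

(* Main.v *)
Require Import Defs.
From HB Require Import structures.
From mathcomp Require Import all_boot all_order all_algebra.
From mathcomp Require Import complex.
From mathcomp Require Import all_classical all_reals all_analysis.
From mathcomp Require Import measurable_realfun exponential_distribution ring lra.

Set Implicit Arguments.
Unset Strict Implicit.
Unset Printing Implicit Defensive.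

Import Order.TTheory GRing.Theory Num.Theory.
Import numFieldNormedType.Exports.

Local Open Scope classical_set_scope.
Local Open Scope ring_scope.
Local Open Scope ereal_scope.

(** Write [I s] for the mass of [|phi|] outside [(-s, s)] and [p = - ln I].
Non-compactness of the support says exactly that [I] never vanishes, and the
exponential moments give [I t <= C exp (- s t)] for every [s > 0].  Hence [p] is
a real, nondecreasing, superlinear function on the half-line
([tail_exponent_real]), and everything else is a Laplace-method argument that
uses only these three properties of [p].

Superlinearity makes the conjugate [p*] finite, and [p*] is itself superlinear.

- Lower bound ([laplace_growth_ge]): since [p] is nondecreasing, the integrand
  [exp (s u - p u)] of [G s] is at least [exp (s t - p t - 1)] on the interval
  [[t - 1/s, t]].  Hence [ln (G s) >= p* s - 1 - ln s] for large [s], and the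
  error [1 + ln s] is negligible against the superlinear [p* s].

- Upper bounds ([laplace_growth_le]): if [t s - p t <= M + w t] with [exp w]
  integrable, then [ln (G s) <= M + c] with [c] independent of [s].  The choice
  [M = p* (s + k)], [w t = - k t] is the Fenchel-Young inequality at the slope
  [s + k].  For [0 < g < 1] and [q] below [p], the splitting
  [t s - q t = (t s - q (g t) / g) + (- q t + q (g t) / g)] allows
  [M = p* s / g], because the supremum over [t] of the first bracket is
  [q* s / g].  This needs [q* <= p*] and the integrability hypothesis for [q].
  Both [q = p] and [q = p**] qualify, since [p** <= p] and [p*** <= p*].
  Letting [g] tend to [1] gives the limit. *)

(** * Limits superior and inferior from eventual bounds *)

Lemma fin_num_between (R : realType) (a b : R) (x : \bar R) :
  a%:E <= x -> x <= b%:E -> x \is a fin_num.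
Proof. by case: x. Qed.

Lemma limf_esup_le_near (R : realType) (T : choiceType)
    (X : filteredType T) (F : set_system X) (FF : Filter F) (f : X -> \bar R) (a : R) :
  (forall e : R, (0 < e)%R -> \forall x \near F, f x <= (a + e)%:E) ->
  limf_esup f F <= a%:E.
Proof.
move=> fa; apply/lee_addgt0Pr => e e0; rewrite limf_esupE -EFinD.
apply: (@le_trans _ _ (ereal_sup (f @` [set x | f x <= (a + e)%:E]))).
  by apply: ereal_inf_lbound; exists [set x | f x <= (a + e)%:E] => //; exact: fa.
by apply: ge_ereal_sup => _ [x fx <-].
Qed.

Lemma limf_einf_ge_near (R : realType) (T : choiceType)
    (X : filteredType T) (F : set_system X) (FF : Filter F) (f : X -> \bar R) (a : R) :
  (forall e : R, (0 < e)%R -> \forall x \near F, (a - e)%:E <= f x) ->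
  a%:E <= limf_einf f F.
Proof.
move=> fa; rewrite /limf_einf leeNr -EFinN; apply: limf_esup_le_near => e e0.
near=> x; rewrite leeNl -EFinN opprD opprK; near: x; exact: fa.
Unshelve. all: by end_near. Qed.

Lemma cvg_squeeze_near (R : realType) (T : Type) (F : set_system T)
    (FF : Filter F) (f : T -> \bar R) (a : R) :
  (forall e : R, (0 < e)%R -> \forall x \near F, (a - e)%:E <= f x) ->
  (forall e : R, (0 < e)%R -> \forall x \near F, f x <= (a + e)%:E) ->
  f @ F --> a%:E.
Proof.
move=> lf uf; apply/fine_cvgP; split.
  near=> x; apply: (@fin_num_between _ (a - 1) (a + 1)).
    by near: x; apply: lf.
  by near: x; apply: uf.
apply/cvgrPdist_le => e e0; near=> x.
have l1 : (a - e)%:E <= f x by near: x; exact: lf.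
have u1 : f x <= (a + e)%:E by near: x; exact: uf.
rewrite /=; move: l1 u1; case: (f x) => [r| |]//=.
by rewrite !lee_fin distrC ler_distl => -> ->.
Unshelve. all: by end_near. Qed.

(** * Legendre transforms *)

Section legendre.
Context {R : realType}.
Implicit Types (f : R -> \bar R) (s t : R).

Lemma legendre_ge f s t : (0 <= t)%R -> (s * t)%:E - f t <= legendre f s.
Proof.
by move=> t0; apply: ereal_sup_ubound; exists t => //=; rewrite in_itv/= t0.
Qed.

Lemma legendre_le f s (M : \bar R) :
  (forall t, (0 <= t)%R -> (s * t)%:E - f t <= M) -> legendre f s <= M.
Proof.
move=> fM; apply: ge_ereal_sup => _ [t /= + <-].
by rewrite in_itv/= andbT; exact: fM.
Qed.

End legendre.

(** The transform as a real number; the default value of [fine] never shows for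
a superlinear [p], by [conjugateE]. *)
Definition conjugate (R : realType) (p : R -> R) (s : R) : R :=
  fine (legendre (EFin \o p) s).

(** * Growth of the Laplace integral of a superlinear exponent *)

Section growth.
Context {R : realType} (p : R -> R).
Hypothesis p_nd : {homo p : x y / (x <= y)%R}.
Hypothesis p_superlinear : forall s : R, exists C : R,
  forall t : R, (0 <= t)%R -> (s * t - C <= p t)%R.

Local Notation mu := (@lebesgue_measure R).
Local Notation pstar := (legendre (EFin \o p)).
Local Notation pstarR := (conjugate p).
Local Notation G := (laplace_growth (EFin \o p)).

Lemma legendre_fin_num s : pstar s \is a fin_num.
Proof.
have [C hC] := p_superlinear s.
apply: (@fin_num_between _ (s * 0 - p 0) C).
  exact: (@legendre_ge _ (EFin \o p) s 0%R (lexx 0%R)).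
apply: legendre_le => t t0 /=; rewrite -EFinB lee_fin.
by rewrite lerBlDr addrC -lerBlDr; exact: hC.
Qed.

Lemma conjugateE s : pstar s = (pstarR s)%:E.
Proof. by rewrite /conjugate fineK// legendre_fin_num. Qed.

(** The Fenchel-Young inequality. *)
Lemma conjugate_ge s t : (0 <= t)%R -> (s * t - p t <= pstarR s)%R.
Proof.
by move=> t0; rewrite -lee_fin -conjugateE; exact: (@legendre_ge _ (EFin \o p)).
Qed.

Lemma conjugate_le s (M : R) :
  (forall t, (0 <= t)%R -> (s * t - p t <= M)%R) -> (pstarR s <= M)%R.
Proof.
move=> h; rewrite -lee_fin -conjugateE; apply: legendre_le => t t0 /=.
by rewrite -EFinB lee_fin; exact: h.
Qed.

(** For [s] beyond [p (A + 1)], the single point [t = A + 1] of the supremum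
already gives [A * s]. *)
Lemma conjugate_superlinear (A : R) : (0 <= A)%R ->
  \forall s \near +oo%R, (A * s <= pstarR s)%R.
Proof.
move=> A0; near=> s.
have A1 : (0 <= A + 1)%R by rewrite addr_ge0.
apply: le_trans (conjugate_ge s A1).
have : (p (A + 1) <= s)%R by near: s; apply: nbhs_pinfty_ge; rewrite num_real.
lra.
Unshelve. all: by end_near. Qed.

Lemma measurable_laplace_integrand (D : set R) s : measurable D ->
  measurable_fun D (EFin \o (fun t : R => expR (t * s - p t))).
Proof.
move=> mD; apply/measurable_EFinP.
apply: measurableT_comp; first exact: measurable_expR.
apply: measurable_funB; first exact: measurable_funM.
exact: nondecreasing_measurable.
Qed.

(** On [[t - 1/s, t]] the term [u * s] is within [1] of its value at [t], and
[p u <= p t] by monotonicity; the length [1/s] of the interval gives the [ln s]. *)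
Lemma laplace_growth_ge s t : (0 < s)%R -> (s^-1 <= t)%R ->
  (expR (s * t - p t - 1 - ln s))%:E <= G s.
Proof.
move=> s0 st.
have si0 : (0 < s^-1)%R by rewrite invr_gt0.
apply: (@le_trans _ _ (\int[mu]_(u in `[(t - s^-1)%R, t])
    expeR ((u * s)%:E - (p u)%:E))); last first.
  apply: ge0_subset_integral => //.
  - exact: measurable_laplace_integrand.
  - by move=> u _; exact: expeR_ge0.
  - by move=> u /=; rewrite !in_itv/= andbT => /andP[+ _]; lra.
apply: (@le_trans _ _ (\int[mu]_(u in `[(t - s^-1)%R, t])
    (cst (expR (s * t - 1 - p t))%:E u))).
  rewrite integral_cst//= lebesgue_measure_itv/= lte_fin ifT; last by lra.
  rewrite -EFinB -EFinM lee_fin opprB addrCA subrr addr0.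
  rewrite (_ : (s * t - p t - 1 - ln s = (s * t - 1 - p t) + - ln s)%R); last by lra.
  by rewrite expRD expRN lnK// posrE.
apply: ge0_le_integral => //.
- by move=> u _; rewrite lee_fin expR_ge0.
- exact: measurable_laplace_integrand.
move=> u /=; rewrite in_itv/= => /andP[u1 u2].
rewrite lee_fin ler_expR lerB ?p_nd//.
have : ((t - s^-1) * s <= u * s)%R by rewrite ler_wpM2r// ltW.
by rewrite mulrBl mulVf ?gt_eqF// mulrC.
Qed.

(** Everything that depends on [s] is in [M], so that the integral of [expeR w]
contributes a constant uniform in [s]. *)
Lemma laplace_growth_le (w : R -> \bar R) :
  mu.-integrable `]0%R, +oo[ (fun t => expeR (w t)) ->
  exists c : R, forall s M : R,
    (forall t, (0 < t)%R -> (t * s)%:E - (p t)%:E <= M%:E + w t) ->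
    G s <= (expR (M + c))%:E.
Proof.
move=> /integrableP[mw]; under eq_integral do rewrite gee0_abs ?expeR_ge0//.
set C := (X in X < _) => wfin.
have C0 : 0 <= C by apply: integral_ge0 => t _; exact: expeR_ge0.
(* C <= 1 + C <= expR C spares the logarithm of a possibly zero integral *)
exists (fine C) => s M h; rewrite /laplace_growth -integral_itv_obnd_cbnd; last first.
  exact: measurable_laplace_integrand.
apply: (@le_trans _ _ (\int[mu]_(t in `]0%R, +oo[) ((expR M)%:E * expeR (w t)))).
  apply: ge0_le_integral => //.
  - by move=> t _; exact: expeR_ge0.
  - exact: measurable_laplace_integrand.
  - exact: measurable_funeM.
  - move=> t /=; rewrite in_itv/= andbT => t0.
    rewrite -[(expR M)%:E]/(expeR M%:E) -expeRD.
    rewrite -[leLHS]/(expeR ((t * s)%:E - (p t)%:E)) lee_expeR; exact: h.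
rewrite ge0_integralZl ?lee_fin ?expR_ge0//; last first.
  by move=> t _; exact: expeR_ge0.
rewrite -/C expRD EFinM lee_pmul ?lee_fin ?expR_ge0//.
rewrite -[leLHS]fineK ?ge0_fin_numE// lee_fin.
by rewrite (le_trans _ (expR_ge1Dx _))// lerDr.
Qed.

Lemma laplace_growth_le_shift (k : R) : (0 < k)%R ->
  exists c : R, forall s, G s <= (expR (pstarR (s + k) + c))%:E.
Proof.
move=> k0.
have [|c hc] := @laplace_growth_le (fun t => (- (k * t))%:E).
  have I1 := integrableZl measurableT k^-1 (integrable_exponential_pdf k0).
  have : mu.-integrable `]0%R, +oo[
      (fun t => k^-1%:E * (exponential_pdf k t)%:E).
    exact: integrableS I1.
  apply: eq_integrable => // t; rewrite inE/= in_itv/= andbT => t0.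
  by rewrite exponential_pdfE ?ltW// -EFinM mulrA mulVf ?gt_eqF// mul1r mulNr.
exists c => s; apply: hc => t t0.
rewrite -EFinB -EFinD lee_fin.
have := conjugate_ge (s + k) (ltW t0); lra.
Qed.

(** The hypotheses on [q] say [q* <= p*] and [q <= p]; the first one is used at
the point [g * t] and divided by [g]. *)
Lemma laplace_growth_le_dilation (q : R -> R) (g : R) : (0 < g)%R ->
  (forall s t, (0 <= s)%R -> (0 <= t)%R -> (s * t - q t <= pstarR s)%R) ->
  (forall t, (0 <= t)%R -> (q t <= p t)%R) ->
  mu.-integrable `]0%R, +oo[
    (fun t => expeR (- (q t)%:E + (g^-1)%:E * (q (g * t))%:E)) ->
  exists c : R, forall s, (0 <= s)%R -> G s <= (expR (g^-1 * pstarR s + c))%:E.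
Proof.
move=> g0 qpstar qp iq.
have [c hc] := laplace_growth_le iq.
exists c => s s0; apply: hc => t t0.
rewrite -EFinB -EFinN -EFinM -!EFinD lee_fin.
have h : (g^-1 * (s * (g * t) - q (g * t)) <= g^-1 * pstarR s)%R.
  by rewrite ler_pM2l ?invr_gt0// qpstar// mulr_ge0// ltW.
have gt : (g^-1 * (s * (g * t)) = t * s)%R by field; rewrite gt_eqF.
rewrite mulrBr gt in h.
have := qp _ (ltW t0); lra.
Qed.

Lemma laplace_growth_expR (s : R) : (0 < s)%R ->
  exists L : R, G s = (expR L)%:E.
Proof.
move=> s0; have [c hc] := laplace_growth_le_shift ltr01.
have lb := laplace_growth_ge s0 (lexx (s^-1)%R).
have Gfin := fin_num_between lb (hc s).
exists (ln (fine (G s))); rewrite lnK ?fineK// posrE.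
by rewrite -lte_fin fineK// (lt_le_trans _ lb)// lte_fin expR_gt0.
Qed.

(** The lower bound on [G] reaches only the points [t >= 1/s] of the supremum
[p* s]; on the other points [s * t - p t <= 1 - p 0], which is eventually
dominated by the lower bound at [t = 1]. *)
Lemma log_ratio_ge (e : R) : (0 < e)%R ->
  \forall s \near +oo%R, (1 - e)%:E <= lne (G s) / pstar s.
Proof.
move=> e0; near=> s.
have s0 : (0 < s)%R by near: s; apply: nbhs_pinfty_gt; rewrite num_real.
have s1 : (1 <= s)%R by near: s; apply: nbhs_pinfty_ge; rewrite num_real.
have sp : (1 - p 0 + p 1 <= s)%R by near: s; apply: nbhs_pinfty_ge; rewrite num_real.
(* 1 + ln s <= 2 * s for s >= 1, hence the slope 2 / e *)
have A : (2 / e * s <= pstarR s)%R.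
  by near: s; apply: conjugate_superlinear; rewrite divr_ge0// ltW.
have ps0 : (0 < pstarR s)%R by apply: lt_le_trans A; rewrite !mulr_gt0 ?invr_gt0.
have [L GL] := laplace_growth_expR s0.
have Lge t : (s^-1 <= t)%R -> (s * t - p t - 1 - ln s <= L)%R.
  by move=> /(laplace_growth_ge s0); rewrite GL lee_fin ler_expR.
have L1 : (s - p 1 - 1 - ln s <= L)%R.
  by have := @Lge 1%R; rewrite mulr1; apply; rewrite invf_le1.
have : (pstarR s <= L + 1 + ln s)%R.
  apply: conjugate_le => t t0; have [st|ts] := leP (s^-1)%R t.
    by have := Lge _ st; lra.
  have st1 : (s * t <= 1)%R by rewrite -ler_pdivlMl// mulr1 ltW.
  by have := p_nd t0; lra.
have := ln_sublinear s0 => lns up.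
rewrite GL conjugateE -[(expR L)%:E]/(expeR L%:E) expeRK inver gt_eqF// -EFinM lee_fin.
rewrite ler_pdivlMr// mulrBl mul1r.
have : (2 * s <= e * pstarR s)%R.
  by move: A; rewrite mulrAC ler_pdivrMr// [(_ * e)%R]mulrC.
lra.
Unshelve. all: by end_near. Qed.

(** A bound on [ln (G s)] with an additive constant [c] gives the ratio bound
because [p*] tends to infinity. *)
Lemma log_ratio_le (g c k : R) : (0 < g)%R -> (0 <= k)%R ->
  (forall s, (0 <= s)%R -> G s <= (expR (g * pstarR (s + k) + c))%:E) ->
  forall e : R, (0 < e)%R ->
  \forall s \near +oo%R, lne (G s) / pstar (s + k)%R <= (g + e)%:E.
Proof.
move=> g0 k0 hc e e0; near=> s.
have s0 : (0 < s)%R by near: s; apply: nbhs_pinfty_gt; rewrite num_real.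
have sk : (s <= s + k)%R by rewrite lerDl.
have sc : (`|c| / e + 1 <= s)%R by near: s; apply: nbhs_pinfty_ge; rewrite num_real.
have A : (s <= pstarR s)%R.
  by rewrite -[leLHS]mul1r; near: s; exact: conjugate_superlinear.
have pmono : (pstarR s <= pstarR (s + k))%R.
  apply: conjugate_le => t t0; apply: le_trans (conjugate_ge (s + k) t0).
  by rewrite lerD2r ler_wpM2r.
have ps0 : (0 < pstarR (s + k))%R by lra.
have [L GL] := laplace_growth_expR s0.
have := hc s (ltW s0); rewrite GL lee_fin ler_expR => Lle.
rewrite conjugateE -[(expR L)%:E]/(expeR L%:E) expeRK inver gt_eqF// -EFinM lee_fin.
rewrite ler_pdivrMr// mulrDl (le_trans Lle)// lerD2l.
apply: (le_trans (ler_norm c)); rewrite mulrC -ler_pdivrMr//; lra.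
Unshelve. all: by end_near. Qed.

Lemma limf_esup_log_ratio_shift (k : R) : (0 < k)%R ->
  limf_esup (fun s => lne (G s) / pstar (s + k)%R) +oo%R <= 1.
Proof.
move=> k0; apply: limf_esup_le_near => e e0.
have [c hc] := laplace_growth_le_shift k0.
by apply: (log_ratio_le (c := c) ltr01 (ltW k0)) => // s _; rewrite mul1r.
Qed.

Lemma cvg_log_ratio_minorant (q : R -> R) :
  (forall s t, (0 <= s)%R -> (0 <= t)%R -> (s * t - q t <= pstarR s)%R) ->
  (forall t, (0 <= t)%R -> (q t <= p t)%R) ->
  dilation_integrable (EFin \o q) ->
  (fun s => lne (G s) / pstar s) @ +oo%R --> (1 : \bar R).
Proof.
move=> qpstar qp dq; apply: cvg_squeeze_near; first exact: log_ratio_ge.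
move=> e e0.
have [g [g0 ge iq]] : exists g : R, [/\ (0 < g)%R, (g^-1 <= 1 + e / 2)%R &
  mu.-integrable `]0%R, +oo[
    (fun t => expeR (- (q t)%:E + (g^-1)%:E * (q (g * t)%R)%:E))].
  have e1 : (0 < 1 + e / 2)%R by lra.
  near (1%R : R)^'- => g.
  have gge : ((1 + e / 2)^-1 <= g)%R.
    near: g; apply: nbhs_left_ge; rewrite invf_lt1//; lra.
  have g0 : (0 < g)%R by apply: lt_le_trans gge; rewrite invr_gt0.
  exists g; split => //; first by rewrite invf_ple.
  by near: g.
have [c hc] := laplace_growth_le_dilation g0 qpstar qp iq.
(* half of e pays for g^-1 - 1, the other half for the additive constant *)
have h := @log_ratio_le g^-1 c 0 _ (lexx _).
near=> s.
apply: (@le_trans _ _ (g^-1 + e / 2)%:E); last by rewrite lee_fin; lra.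
rewrite -[X in pstar X]addr0; near: s; apply: h.
- by rewrite invr_gt0.
- by move=> s s0; rewrite addr0 hc.
- by rewrite divr_gt0.
Unshelve. all: by end_near. Qed.

(** At [t >= 0] this is [p** <= p]; at a negative [t], where the supremum still
runs over [s >= 0], the bound comes from [p** t <= p** 0 <= p 0].  It makes [p**]
finite on the whole line. *)
Lemma biconjugate_le t : legendre pstar t <= (p (Num.max t 0))%:E.
Proof.
apply: legendre_le => s s0; rewrite conjugateE -EFinB lee_fin lerBlDr.
have m0 : (0 <= Num.max t 0)%R by rewrite le_max lexx orbT.
have : (t * s <= s * Num.max t 0)%R by rewrite mulrC ler_wpM2l// le_max lexx.
have := conjugate_ge s m0; lra.
Qed.

Lemma biconjugate_fin_num t : legendre pstar t \is a fin_num.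
Proof.
apply: fin_num_between (biconjugate_le t).
  by have := @legendre_ge _ pstar t 0%R (lexx _); rewrite conjugateE; exact.
Qed.

Lemma cvg_log_ratio :
  dilation_integrable (EFin \o p) \/ dilation_integrable (legendre pstar) ->
  (fun s => lne (G s) / pstar s) @ +oo%R --> (1 : \bar R).
Proof.
case; first by apply: cvg_log_ratio_minorant => // s t _; exact: conjugate_ge.
pose q t : R := fine (legendre pstar t).
have qE : legendre pstar = EFin \o q.
  by apply/funext => t; rewrite /q /= fineK// biconjugate_fin_num.
move=> dq; apply: (@cvg_log_ratio_minorant q); last by rewrite -qE.
- move=> s t s0 t0; rewrite lerBlDr -lerBlDl mulrC -lee_fin EFinB -conjugateE.
  by rewrite -[leRHS]/((EFin \o q) t) -qE; exact: legendre_ge.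
- move=> t t0; have := biconjugate_le t.
  by rewrite (max_idPl t0) qE lee_fin.
Qed.

End growth.

(** * The tail exponent *)

Definition tail_mass (R : realType) (phi : R -> R[i]) (s : R) : \bar R :=
  \int[@lebesgue_measure R]_(t in [set t : R | (s <= `|t|)%R]) (cmod (phi t))%:E.

Section tail.
Context {R : realType} (phi : R -> R[i]).
Hypothesis phi_L1 : complex_L1 phi.
Hypothesis phi_supp : ~ compact (ess_support phi).
Hypothesis phi_exp : forall s : R, (0 < s)%R ->
  \int[@lebesgue_measure R]_t (expR (`|t| * s) * cmod (phi t))%:E < +oo.

Local Notation mu := (@lebesgue_measure R).
Local Notation D s := [set t : R | (s <= `|t|)%R].
Local Notation I := (tail_mass phi).

Lemma cmod_ge0 (z : R[i]) : (0 <= cmod z)%R.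
Proof. by case: z => a b; exact: sqrtr_ge0. Qed.

Lemma measurable_outer (s : R) : measurable (D s).
Proof.
rewrite (_ : D s = setT `&` (@Num.norm R R) @^-1` `[s, +oo[); last first.
  by apply/seteqP; split => t /=; rewrite in_itv/= andbT; tauto.
by apply: normr_measurable.
Qed.

Lemma measurable_cmod (E : set R) :
  measurable E -> measurable_fun E (fun t : R => cmod (phi t)).
Proof.
move=> mE; have [/integrableP[/measurable_EFinP mRe _]
  /integrableP[/measurable_EFinP mIm _]] := phi_L1.
apply: (@measurable_funS _ _ _ _ setT) => //.
have -> : (fun t : R => cmod (phi t)) = Num.sqrt \o
    (fun t : R => complex.Re (phi t) ^+ 2 + complex.Im (phi t) ^+ 2)%R.
  by apply/funext => t /=; case: (phi t).
apply: measurableT_comp.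
  by apply: continuous_measurable_fun; exact: sqrt_continuous.
by apply: measurable_funD; exact: measurable_funX.
Qed.

Lemma emeasurable_cmod (E : set R) : measurable E ->
  measurable_fun E (EFin \o (fun t : R => cmod (phi t))).
Proof. by move=> mE; apply/measurable_EFinP; exact: measurable_cmod. Qed.

Lemma tail_mass_ge0 s : 0 <= I s.
Proof. by apply: integral_ge0 => t _; rewrite lee_fin cmod_ge0. Qed.

Lemma tail_mass_nonincreasing (s t : R) : (s <= t)%R -> I t <= I s.
Proof.
move=> st; apply: ge0_subset_integral.
- exact: measurable_outer.
- exact: measurable_outer.
- exact: (emeasurable_cmod (measurable_outer _)).
- by move=> u _; rewrite lee_fin cmod_ge0.
- by move=> u /=; exact: le_trans.
Qed.

(** Markov's inequality for the exponential moment of order [s]. *)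
Lemma tail_mass_exp_bound (s : R) : (0 < s)%R ->
  exists C : R, forall t, (0 <= t)%R -> I t <= (expR (C - s * t))%:E.
Proof.
move=> s0; have := phi_exp s0; set K := (X in X < _) => Kfin.
have K0 : 0 <= K.
  by apply: integral_ge0 => t _; rewrite lee_fin mulr_ge0 ?expR_ge0 ?cmod_ge0.
(* K <= expR K avoids ln K, and with it the positivity of K *)
exists (fine K) => t t0; have mDt := measurable_outer t.
have mexp : measurable_fun [set: R]
    (EFin \o (fun u : R => (expR (`|u| * s) * cmod (phi u))%R)).
  apply/measurable_EFinP; apply: measurable_funM; last exact: measurable_cmod.
  apply: measurableT_comp; first exact: measurable_expR.
  by apply: measurable_funM => //; exact: normr_measurable.
have IK : (expR (s * t))%:E * I t <= K.
  rewrite /tail_mass -ge0_integralZl ?lee_fin ?expR_ge0//; last 2 first.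
  - exact: (emeasurable_cmod (measurable_outer _)).
  - by move=> u _; rewrite lee_fin cmod_ge0.
  apply: (@le_trans _ _ (\int[mu]_(u in D t) (expR (`|u| * s) * cmod (phi u))%:E)).
    apply: ge0_le_integral => //.
    - by move=> u _; rewrite mule_ge0// lee_fin ?expR_ge0 ?cmod_ge0.
    - by apply: measurable_funeM; exact: (emeasurable_cmod (measurable_outer _)).
    - exact: measurable_funS mexp.
    move=> u /= tu; rewrite -EFinM lee_fin ler_wpM2r ?cmod_ge0//.
    by rewrite ler_expR mulrC ler_wpM2r// ltW.
  apply: ge0_subset_integral => //.
  by move=> u _; rewrite lee_fin mulr_ge0 ?expR_ge0 ?cmod_ge0.
have -> : (expR (fine K - s * t))%:E = (expR (- (s * t)))%:E * (expR (fine K))%:E.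
  by rewrite -EFinM -expRD addrC.
have <- : (expR (- (s * t)))%:E * ((expR (s * t))%:E * I t) = I t.
  by rewrite muleA -EFinM -expRD addNr expR0 mul1e.
rewrite lee_pmul2l ?lte_fin ?expR_gt0// (le_trans IK)//.
rewrite -[leLHS]fineK ?ge0_fin_numE// lee_fin.
by rewrite (le_trans _ (expR_ge1Dx _))// lerDr.
Qed.

(** If the tail beyond [s] vanished, [phi] would be null on the complement of
[[-s, s]], so its essential support would be a closed part of a segment. *)
Lemma tail_mass_gt0 (s : R) : 0 < I s.
Proof.
rewrite lt_neqAle tail_mass_ge0 andbT; apply/eqP => /esym I0; apply: phi_supp.
apply: (@subclosed_compact _ _ `[(- s)%R, s]).
- rewrite /ess_support; apply: open_closedC; apply: bigcup_open.
  by move=> U [].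
- exact: segment_compact.
move=> t; apply: contra_notP => nt.
exists (~` `[(- s)%R, s]) => //; split.
  by apply: closed_openC; exact: interval_closed.
have I0' : \int[mu]_(u in D s) `|(cmod (phi u))%:E| = 0.
  by rewrite -I0; apply: eq_integral => u _; rewrite gee0_abs// lee_fin cmod_ge0.
have mD := measurable_outer s.
have := (ae_eq_integral_abs mu mD (emeasurable_cmod mD)).1 I0'.
apply: filterS => u h /= nu.
have su : (s < `|u|)%R.
  by rewrite ltNge; apply/negP => us; apply: nu; rewrite in_itv/= -ler_norml.
have [phi0] : (cmod (phi u))%:E = 0 := h (ltW su).
exact: Normc.eq0_normc phi0.
Qed.

Lemma tail_mass_fin_num s : I s \is a fin_num.
Proof.
have [C hC] := tail_mass_exp_bound ltr01.
rewrite ge0_fin_numE ?tail_mass_ge0//.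
have [s0|/ltW s0] := leP 0%R s; first by rewrite (le_lt_trans (hC _ s0))// ltry.
(* for s <= 0 the domain of integration is the whole line, as for s = 0 *)
have -> : I s = I 0%R.
  rewrite /tail_mass; congr (integral _ _ _); apply/seteqP.
  by split => t /= _; [exact: normr_ge0|exact: le_trans s0 (normr_ge0 _)].
by rewrite (le_lt_trans (hC _ (lexx _)))// ltry.
Qed.

Lemma fine_tail_mass_gt0 s : (0 < fine (I s))%R.
Proof. by rewrite fine_gt0 ?tail_mass_gt0 ?ltey_eq ?tail_mass_fin_num. Qed.

(** All that the growth estimates need to know about [phi]. *)
Lemma tail_exponent_real :
  exists p : R -> R, [/\ tail_exponent phi = EFin \o p,
    {homo p : x y / (x <= y)%R} &
    forall s : R, exists C : R, forall t : R, (0 <= t)%R -> (s * t - C <= p t)%R].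
Proof.
exists (fun s => - ln (fine (I s)))%R; split.
- apply/funext => s; rewrite /tail_exponent -[X in lne X]/(I s) /= EFinN.
  by rewrite -{1}[I s]fineK ?tail_mass_fin_num// lne_EFin ?fine_tail_mass_gt0.
- move=> s t st; rewrite lerN2 ler_ln ?posrE ?fine_tail_mass_gt0//.
  by rewrite fine_le ?tail_mass_fin_num// tail_mass_nonincreasing.
(* exponential moments are given for positive orders, hence 1 + `|s| for s *)
move=> s; have [C hC] := tail_mass_exp_bound (ltr_pwDl ltr01 (normr_ge0 s)).
exists C => t t0; rewrite lerNr.
apply: (@le_trans _ _ (C - (1 + `|s|) * t)%R).
  rewrite -ler_expR lnK ?posrE ?fine_tail_mass_gt0// -lee_fin.
  by rewrite fineK ?tail_mass_fin_num//; exact: hC.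
have : (s * t <= (1 + `|s|) * t)%R.
  by rewrite ler_wpM2r// (le_trans (ler_norm s))// lerDr.
lra.
Qed.

End tail.

(** * The three asymptotic comparisons *)

Theorem theorem3 (R : realType) (phi : R -> R[i])
    (phi_L1 : complex_L1 phi)
    (phi_supp : ~ compact (ess_support phi))
    (phi_exp : forall s : R, (0 < s)%R ->
       \int[@lebesgue_measure R]_t (expR (`|t| * s) * cmod (phi t))%:E < +oo) :
  let p := tail_exponent phi in
  let pstar := legendre p in
  let pstarstar := legendre pstar in
  let G := laplace_growth p in
  [/\ 1 <= limf_einf (fun s : R => lne (G s) / pstar s) +oo%R,
      forall kappa : R, (0 < kappa)%R ->
        limf_esup (fun s : R => lne (G s) / pstar (s + kappa)%R) +oo%R <= 1
    & dilation_integrable p \/ dilation_integrable pstarstar ->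
        (fun s : R => lne (G s) / pstar s) @ +oo%R --> (1 : \bar R)].
Proof.
move=> p pstar pstarstar G.
have [f [pf f_nd f_sup]] := tail_exponent_real phi_L1 phi_supp phi_exp.
rewrite /G /pstarstar /pstar /p pf; split.
- by apply: limf_einf_ge_near; exact: log_ratio_ge.
- exact: limf_esup_log_ratio_shift.
- exact: cvg_log_ratio.
Qed.
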